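(* Let $p$ be an odd prime, $L=\mathbb F_{p^m}$, $\sigma=p^s$ with $0<s<m$, and let $K_1=\{x\in L:x^{\sigma}=x\}=\mathbb F_{p^{\gcd(m,s)}}$. For every presemifield $B(p,m,s,l,n,N)$ and every presemifield $C(p,m,s,l,R)$, the associated semifield has left nucleus and right nucleus both equal to $K_1\subset L$ (where $L$ is identified with $L\times\{0\}$).
   Context: A finite presemifield $(F,+,* )$ is a finite abelian group $(F,+)$ with a multiplication satisfying both distributive laws and such that $x*y=0$ implies $x=0$ or $y=0$; a semifield is a presemifield with identity. For an integer $k\ge0$, $L^k=\{x^k:x\in L\}$. $B(p,m,s,l,n,N)$ is defined for $l,n,N\in L^*$ with $-l\notin L^{\sigma-1}$ and $x^{\sigma+1}+(1-1/N)x+(1/n-1)/N\ne0$ for all $x\in L$: it is $F=L^2$ with multiplication $(a,b)*(c,d)=(h(a,b,c,d),\,ad+bc)$, where $$h(a,b,c,d)=ac^{\sigma}-nNbd^{\sigma}+l(a^{\sigma}c-nNb^{\sigma}d)+n\{Nad^{\sigma}-bc^{\sigma}+l(a^{\sigma}d-Nb^{\sigma}c)\}.$$ $C(p,m,s,l,R)$ is defined for $l,R\in L^*$ with $-l\notin L^{\sigma-1}$ and $R\notin L^{\sigma+1}$: it is $F=L^2$ with multiplication $(a,b)*(c,d)=\big(ac^{\sigma}+Rbd^{\sigma}+l(a^{\sigma}c+Rb^{\sigma}d),\ ad+bc\big)$. Associated semifield: put $e=(1,0)$, define $\beta,\gamma\colon F\to F$ by $e*\beta(x)=x$ and $\gamma(x)*e=e*x$,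 and set $x\circ y=\beta(\gamma(x)*y)$. Then $(F,+,\circ)$ is a semifield isotopic to $(F,+,* )$ with identity $e$ (isotopic semifields have isomorphic nuclei). The set $L\times\{0\}\subset F$ is identified with $L$. Nuclei of a semifield $(F,+,\circ)$: the left nucleus is $\{u:(u\circ x)\circ y=u\circ(x\circ y)\ \forall x,y\in F\}$; the right nucleus is $\{u:(x\circ y)\circ u=x\circ(y\circ u)\ \forall x,y\in F\}$. *)

(* Defs.v *)
From HB Require Import structures.
From mathcomp Require Import all_boot all_order all_algebra all_field.
From mathcomp Require Import ring.

Set Implicit Arguments.
Unset Strict Implicit.
Unset Printing Implicit Defensive.

Import GRing.Theory.
Local Open Scope ring_scope.

Section Presemifields.

Variable F : finZmodType.
Implicit Types (mul : F -> F -> F) (e x y u : F).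

Definition presemifield mul : Prop :=
  [/\ left_distributive mul +%R,
      right_distributive mul +%R
    & forall x y, mul x y = 0 -> x = 0 \/ y = 0].

Definition semifield mul e : Prop :=
  [/\ presemifield mul, left_id e mul & right_id e mul].

(* The unique y with mul e y = x, when mul is a presemifield and e != 0
   (see assoc_betaK); the default 0 is then never reached. *)
Definition assoc_beta mul e x : F := odflt 0 [pick y | mul e y == x].

(* The unique y with mul y e = mul e x, under the same assumptions
   (see assoc_gammaK). *)
Definition assoc_gamma mul e x : F := odflt 0 [pick y | mul y e == mul e x].

Definition assoc_mul mul e x y : F :=
  assoc_beta mul e (mul (assoc_gamma mul e x) y).

Definition left_nucleus mul : {set F} :=
  [set u | [forall x, forall y, mul (mul u x) y == mul u (mul x y)]].

Definition right_nucleus mul : {set F} :=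
  [set u | [forall x, forall y, mul (mul x y) u == mul x (mul y u)]].

Lemma presemifield_mulIl mul e :
  presemifield mul -> e != 0 -> injective (mul e).
Proof.
move=> [_ mulDr mul_eq0] e0 x y eq_xy; apply/eqP; rewrite -subr_eq0; apply/eqP.
have e_0 : mul e 0 = 0.
  by apply: (addrI (mul e 0)); rewrite -mulDr !addr0.
have : mul e (x - y) = 0.
  by apply: (addIr (mul e y)); rewrite -mulDr subrK add0r.
by case/mul_eq0 => // e_eq0; rewrite e_eq0 eqxx in e0.
Qed.

Lemma presemifield_mulIr mul e :
  presemifield mul -> e != 0 -> injective (mul^~ e).
Proof.
move=> [mulDl mulDr mul_eq0] e0; apply: (@presemifield_mulIl (fun x y => mul y x)) => //.
by split=> [x y z | x y z | x y /mul_eq0 []]; [exact: mulDr | exact: mulDl | right | left].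
Qed.

Lemma assoc_betaK mul e x :
  presemifield mul -> e != 0 -> mul e (assoc_beta mul e x) = x.
Proof.
move=> psf e0; rewrite /assoc_beta; case: pickP => [y /eqP // | no_y].
have inj := presemifield_mulIl psf e0.
by have := no_y (invF inj x); rewrite (f_invF inj) eqxx.
Qed.

Lemma assoc_gammaK mul e x :
  presemifield mul -> e != 0 -> mul (assoc_gamma mul e x) e = mul e x.
Proof.
move=> psf e0; rewrite /assoc_gamma; case: pickP => [y /eqP // | no_y].
have inj := presemifield_mulIr psf e0.
by have := no_y (invF inj (mul e x)); rewrite (f_invF inj) eqxx.
Qed.

Lemma assoc_semifield mul e :
  presemifield mul -> e != 0 -> semifield (assoc_mul mul e) e.
Proof.
move=> psf e0; have [mulDl mulDr mul_eq0] := psf.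
have injl := presemifield_mulIl psf e0; have injr := presemifield_mulIr psf e0.
have betaK x := assoc_betaK x psf e0; have gammaK x := assoc_gammaK x psf e0.
have betaD x y : assoc_beta mul e (x + y) = assoc_beta mul e x + assoc_beta mul e y.
  by apply: injl; rewrite mulDr !betaK.
have gammaD x y : assoc_gamma mul e (x + y) = assoc_gamma mul e x + assoc_gamma mul e y.
  by apply: injr; rewrite /= mulDl !gammaK mulDr.
have e_0 : mul e 0 = 0 by apply: (addrI (mul e 0)); rewrite -mulDr !addr0.
have z_e : mul 0 e = 0 by apply: (addrI (mul 0 e)); rewrite -mulDl !addr0.
split; first split.
- by move=> x y z; rewrite /assoc_mul gammaD mulDl betaD.
- by move=> x y z; rewrite /assoc_mul mulDr betaD.
- move=> x y; rewrite /assoc_mul => /(congr1 (mul e)); rewrite betaK e_0.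
  case/mul_eq0 => [g0 | ->]; [left | by right].
  by apply: injl; rewrite -gammaK g0 z_e e_0.
- move=> x; rewrite /assoc_mul; apply: injl; rewrite betaK.
  by congr (mul _ x); apply: injr; rewrite /= gammaK.
- by move=> x; rewrite /assoc_mul; apply: injl; rewrite betaK gammaK.
Qed.

End Presemifields.

(* Makes L * L a finZmodType, which finalg does not declare. *)
HB.saturate prod.

Section Families.

Variable L : finFieldType.
Implicit Types (p s k : nat) (l n N R : L).

Definition powers k : {set L} := [set x ^+ k | x : L].

Definition B_params p s l n N : Prop :=
  let sigma := (p ^ s)%N in
  [/\ [/\ l != 0, n != 0 & N != 0],
      - l \notin powers (sigma - 1)
    & forall x : L,
        x ^+ (sigma + 1) + (1 - 1 / N) * x + (1 / n - 1) / N != 0].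

Definition B_mul p s l n N (u v : (L * L)%type) : (L * L)%type :=
  let sigma := (p ^ s)%N in
  let: (a, b) := u in let: (c, d) := v in
  (a * c ^+ sigma - n * N * b * d ^+ sigma
     + l * (a ^+ sigma * c - n * N * b ^+ sigma * d)
     + n * (N * a * d ^+ sigma - b * c ^+ sigma
            + l * (a ^+ sigma * d - N * b ^+ sigma * c)),
   a * d + b * c).

Definition C_params p s l R : Prop :=
  let sigma := (p ^ s)%N in
  [/\ l != 0, R != 0, - l \notin powers (sigma - 1)
    & R \notin powers (sigma + 1)].

Definition C_mul p s l R (u v : (L * L)%type) : (L * L)%type :=
  let sigma := (p ^ s)%N in
  let: (a, b) := u in let: (c, d) := v in
  (a * c ^+ sigma + R * b * d ^+ sigma
     + l * (a ^+ sigma * c + R * b ^+ sigma * d),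
   a * d + b * c).

Definition e0 : (L * L)%type := (1, 0).

Definition K1 p s : {set L} := [set x | x ^+ (p ^ s) == x].

Definition embed (A : {set L}) : {set L * L} := [set (x, 0) | x in A].

Lemma e0_neq0 : e0 != 0.
Proof. by apply/eqP => -[/eqP]; rewrite oner_eq0. Qed.

Section Presemifield_families.

Variables (p m s : nat).
Hypotheses (p_pr : prime p) (cardL : #|L| = (p ^ m)%N).

Local Notation sigma := (p ^ s)%N.

Let sigmaD (x y : L) : (x + y) ^+ sigma = x ^+ sigma + y ^+ sigma.
Proof.
have pcharLp := card_finPcharP cardL p_pr.
by rewrite exprDn_pchar // pnatX pnatE // pcharLp.
Qed.

Let sigmaN (x : L) : (- x) ^+ sigma = - x ^+ sigma.
Proof.
apply: (addrI (x ^+ sigma)); rewrite -sigmaD !subrr expr0n.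
by rewrite expn_eq0 -leqn0 leqNgt prime_gt0.
Qed.

(* ad + bc = 0 with (a, b) != 0 forces (c, d) = t (a, - b). *)
Let colinear (a b c d : L) : a * d + b * c = 0 ->
  (a, b) = 0 \/ exists t, c = t * a /\ d = - (t * b).
Proof.
move=> eq0; have [a0 | a0] := eqVneq a 0.
  have [b0 | b0] := eqVneq b 0; first by left; rewrite a0 b0.
  right; exists (- (d / b)); move: eq0; rewrite a0 mul0r add0r mulr0.
  by move/eqP; rewrite mulf_eq0 (negPf b0) => /eqP ->; rewrite mulNr opprK divfK.
right; exists (c / a); rewrite divfK //; split=> //.
apply: (mulfI a0); have -> : a * d = - (b * c) by apply/eqP; rewrite -addr_eq0 eq0.
by rewrite mulrN mulrA [a * _]mulrC divfK // mulrC.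
Qed.

Let lin_neq0 l (t : L) : - l \notin powers (sigma - 1) ->
  t ^+ sigma + l * t = 0 -> t = 0.
Proof.
move=> l_nP; have [// | t0] := eqVneq t 0.
rewrite -{1}[sigma](@subnK 1) ?expn_gt0 ?prime_gt0 // exprD expr1 -mulrDl => /eqP.
rewrite mulf_eq0 (negPf t0) orbF addr_eq0 => /eqP tE.
by case/imsetP: l_nP; exists t; rewrite // tE opprK.
Qed.

Let sigma_gt0 : (0 < sigma)%N.
Proof. by rewrite expn_gt0 prime_gt0. Qed.

Lemma C_presemifield l R : C_params p s l R -> presemifield (C_mul p s l R).
Proof.
move=> [_ _ lP RP]; split.
- by move=> [a b] [a' b'] [c d]; congr pair; rewrite /= ?sigmaD; ring.
- by move=> [a b] [a' b'] [c d]; congr pair; rewrite /= ?sigmaD; ring.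
move=> [a b] [c d] [h0 /colinear [| [t [cE dE]]]]; first by left.
have: (t ^+ sigma + l * t) * (a ^+ (sigma + 1) - R * b ^+ (sigma + 1)) = 0.
  rewrite -[RHS]h0 cE dE sigmaN !exprMn !exprD !expr1.
  by ring.
move/eqP; rewrite mulf_eq0 => /orP [/eqP /(lin_neq0 lP) t0 | ].
  by right; rewrite cE dE t0 !mul0r oppr0.
rewrite subr_eq0 => /eqP abE; left.
have b0 : b = 0.
  apply: contraNeq RP => b0; apply/imsetP; exists (a / b) => //.
  by rewrite expr_div_n abE mulfK // expf_neq0.
move: abE; rewrite b0 [0 ^+ _]expr0n addn1 mulr0 => /eqP.
by rewrite expf_eq0 => /eqP ->.
Qed.

Lemma B_presemifield l n N :
  B_params p s l n N -> presemifield (B_mul p s l n N).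
Proof.
move=> [[l0 n0 N0] lP QP]; split.
- by move=> [a b] [a' b'] [c d]; congr pair; rewrite /= ?sigmaD; ring.
- by move=> [a b] [a' b'] [c d]; congr pair; rewrite /= ?sigmaD; ring.
move=> [a b] [c d] [h0 /colinear [| [t [cE dE]]]]; first by left.
have: (t ^+ sigma + l * t) * (a ^+ (sigma + 1) + n * N * b ^+ (sigma + 1)
        - n * N * a * b ^+ sigma - n * a ^+ sigma * b) = 0.
  rewrite -[RHS]h0 cE dE sigmaN !exprMn !exprD !expr1.
  by ring.
move/eqP; rewrite mulf_eq0 => /orP [/eqP /(lin_neq0 lP) t0 | ].
  by right; rewrite cE dE t0 !mul0r oppr0.
move=> /eqP abE; left; have [a0 | a0] := eqVneq a 0.
  move: abE; rewrite a0 addn1 !exprS !expr0n eqn0Ngt sigma_gt0.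
  rewrite !(mulr0, mul0r) add0r !subr0 => /eqP.
  by rewrite -exprS mulf_eq0 mulf_eq0 (negPf n0) (negPf N0) expf_eq0 /= => /eqP ->.
case/eqP: (QP (b / a - 1)).
have as0 : a ^+ sigma != 0 by rewrite expf_neq0.
have inv_sub : (b / a - 1) ^+ sigma = b ^+ sigma / a ^+ sigma - 1.
  by rewrite sigmaD sigmaN expr1n expr_div_n.
rewrite exprD expr1 inv_sub.
move: abE; rewrite !exprD !expr1; move: (a ^+ sigma) (b ^+ sigma) as0 => A B as0 abE.
have -> : (B / A - 1) * (b / a - 1) + (1 - 1 / N) * (b / a - 1) + (1 / n - 1) / N
  = (A * a + n * N * (B * b) - n * N * a * B - n * A * b) / (n * N * A * a).
  by field; rewrite n0 N0 as0 a0.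
by rewrite abE mul0r.
Qed.

End Presemifield_families.

End Families.

(* Main.v *)
Require Import Defs.
From mathcomp Require Import all_boot all_order all_algebra all_field.
From HB Require Import structures.
From mathcomp Require Import ring.

(** Write [sigma] for the automorphism x |-> x ^ (p ^ s) of L.  Both families
    are instances of one product on L * L ([sesq_mul]): its second component is
    a * d + b * c, and its first one is Phi(u, v') + l * Phi(v', u), where
    v' = (c, - d) for v = (c, d), and Phi is a form on L * L which is linear in
    its first argument and sigma-semilinear in the second.  On collinear
    vectors u = a * z and v' = c * z the second component vanishes, and the
    first one is Q(z) * (a * sigma c + l * sigma a * c) with Q(z) = Phi(z, z).
    Since the product has no zero divisors, Q is anisotropic and a + l * sigma a
    is a bijection of L.

    The right multiplication T by an element of the right nucleus satisfies
    S (v * y) = v * T y for an additive S ([right_nucleusP]).  Restricting this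
    to collinear vectors shows, for two coordinate functions f built from S,
    that f (Q z * (a * sigma c + l * sigma a * c)) is linear in a, for all z.
    The crux is [form_factor_eq0]: such an f is zero.  Otherwise f is
    determined, up to a constant, as the inverse of a |-> a + l * sigma a, and
    comparing the values of f on different lines forces sigma to be involutive
    and the values of Q to be fixed by sigma.  So Q is a Hermitian form in two
    variables over a finite field, and such a form has an isotropic vector
    because the norm is onto the fixed field ([norm_onto_fixed]); this
    contradicts anisotropy.  Once both functions f vanish, T is multiplication
    by a scalar w with sigma w = w ([right_autotopism_scalar]).

    The left nucleus is the right nucleus for the opposite product, and the
    opposite of a product of this shape is again one, with l replaced by its
    inverse, up to scaling the first component ([sesq_mulC]).

    The size of K1 is the number of roots of X ^ (p ^ g) - X for g = gcd(m, s),
    which divides X ^ (p ^ m) - X, the product of all linear factors over L. *)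

Set Implicit Arguments.
Unset Strict Implicit.
Unset Printing Implicit Defensive.

Import GRing.Theory.

(** Lets [ring] derive one equation from another when their two differences
    of sides agree. *)
Lemma eq_of_sub_eq (V : zmodType) (a b x y : V) :
  a = b -> (x - y = a - b -> x = y)%R.
Proof. by move=> -> /eqP; rewrite subrr subr_eq0 => /eqP. Qed.

(** * Fixed fields of Frobenius powers *)

Section FiniteFields.

Local Open Scope ring_scope.

Variable L : finFieldType.

(** X ^ #|L| - X is the product of the X - x over all x in L, so each of its
    divisors is, up to a unit, a product of distinct linear factors. *)
Lemma card_root_dvdp_genPoly (P : {poly L}) :
  P %| 'X^#|L| - 'X -> #|[set x | root P x]| = (size P).-1.
Proof.
rewrite finField_genPoly => /dvdp_prod_XsubC [mk PE].
have uniq_r : uniq (mask mk (index_enum L)).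
  by rewrite mask_uniq ?index_enum_uniq.
rewrite (eqp_size PE) size_prod_XsubC /= -(card_uniqP uniq_r) cardsE.
by apply: eq_card => x; rewrite [LHS](eqp_root PE) root_prod_XsubC.
Qed.

Lemma XnS_subX (k : nat) : 'X^(k.+1) - 'X = 'X * ('X^k - 1) :> {poly L}.
Proof. by rewrite mulrBr mulr1 exprS. Qed.

Lemma dvdp_Xn_subC (c : L) (a b : nat) :
  'X^a - c%:P %| 'X^(a * b) - (c ^+ b)%:P.
Proof. by rewrite exprM rmorphXn subrXX dvdp_mulr. Qed.

(** Surjectivity of the norm from the field of r ^ 2 elements to the subfield of
    r elements.  As t ^ (r - 1) = 1 for t != 0, the polynomial X ^ (r + 1) - t
    divides X ^ (r ^ 2 - 1) - 1, so it splits over L and has a root. *)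
Lemma norm_onto_subfield (r : nat) (t : L) :
  (1 < r)%N -> #|L| = (r ^ 2)%N -> t ^+ r = t -> exists x : L, x * x ^+ r = t.
Proof.
move=> r_gt1 cardL tr; have r_gt0 := ltnW r_gt1.
have [-> | t0] := eqVneq t 0; first by exists 0; rewrite mul0r.
have tr1 : t ^+ r.-1 = 1.
  by apply: (mulfI t0); rewrite -exprS prednK // tr mulr1.
have dvdP : 'X^(r.+1) - t%:P %| 'X^#|L| - 'X.
  have -> : #|L| = (r.+1 * r.-1).+1.
    by rewrite cardL; case: (r) r_gt0 => //= k _; ring.
  rewrite XnS_subX dvdp_mull //.
  by rewrite -[1]/(1%:P) -tr1 dvdp_Xn_subC.
have: #|[set x | root ('X^(r.+1) - t%:P) x]| != 0%N.
  by rewrite card_root_dvdp_genPoly // size_XnsubC.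
rewrite cards_eq0 => /set0Pn [x]; rewrite inE rootE !hornerE subr_eq0 => /eqP xE.
by exists x; rewrite -exprS.
Qed.

Section FixedField.

Variables (p m : nat).
Hypotheses (p_pr : prime p) (cardL : #|L| = (p ^ m)%N).

Let m_gt0 : (0 < m)%N.
Proof. by have := finNzRing_gt1 L; rewrite cardL; case: (m). Qed.

Let expr_iter s (x : L) k : x ^+ (p ^ s) = x -> x ^+ (p ^ (k * s)) = x.
Proof.
by move=> xs; elim: k => [|k IH]; rewrite ?expr1 // mulSn expnD exprM xs.
Qed.

(** A point fixed by the s-th and m-th powers of the Frobenius map is fixed by
    the g-th power, g = gcd(s, m), by Bezout; and all of L is fixed by the m-th
    power.  Then X ^ (p ^ g) - X divides X ^ (p ^ m) - X, since p ^ g - 1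
    divides p ^ m - 1. *)
Lemma card_K1 s : (0 < s)%N -> #|K1 L p s| = (p ^ gcdn m s)%N.
Proof.
move=> s_gt0; rewrite gcdnC.
have xm (x : L) : x ^+ (p ^ m) = x by rewrite -cardL expf_card.
have g_gt0 : (0 < gcdn s m)%N by rewrite gcdn_gt0 s_gt0.
have pg_gt1 : (1 < p ^ gcdn s m)%N.
  by rewrite -(exp1n (gcdn s m)) ltn_exp2r ?prime_gt1.
have K1E : K1 L p s = [set x | root ('X^(p ^ gcdn s m) - 'X) x].
  apply/setP => x; rewrite !inE rootE !hornerE subr_eq0; apply/eqP/eqP => xE.
    case: (egcdnP m s_gt0) => u v uvE _; have := expr_iter u xE.
    by rewrite uvE expnD exprM (expr_iter v (xm x)).
  by have /dvdnP [k ->] := dvdn_gcdl s m; exact: expr_iter.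
rewrite K1E card_root_dvdp_genPoly.
  by rewrite size_polyDl ?size_polyXn // size_polyN size_polyX.
have /dvdnP [k mE] := dvdn_gcdr s m; rewrite cardL.
set q := (p ^ gcdn s m)%N in pg_gt1 *.
have /dvdnP [j jE] : (q.-1 %| (p ^ m).-1)%N.
  by rewrite mE mulnC expnM predn_exp dvdn_mulr.
have q_gt0 := ltnW pg_gt1.
have -> : (p ^ m)%N = (q.-1 * j).+1.
  by rewrite mulnC -jE prednK ?expn_gt0 ?prime_gt0.
rewrite -{1}(prednK q_gt0) !XnS_subX dvdp_mul //.
by have := dvdp_Xn_subC 1 q.-1 j; rewrite expr1n.
Qed.

Variable s : nat.
Hypothesis s_bounds : (0 < s < m)%N.

Lemma K1_proper : exists x : L, x ^+ (p ^ s) != x.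
Proof.
have /andP [s_gt0 s_lt_m] := s_bounds.
case: (pickP (fun x : L => x ^+ (p ^ s) != x)) => [x xP | fix_all].
  by exists x.
have K1T : K1 L p s = setT.
  by apply/setP => x; rewrite !inE; apply/negPn/negbT/fix_all.
have := card_K1 s_gt0; rewrite K1T cardsT cardL => /eqP.
rewrite eqn_exp2l ?prime_gt1 // => /eqP mE.
by have := dvdn_leq s_gt0 (dvdn_gcdr m s); rewrite -mE leqNgt s_lt_m.
Qed.

(** An involutive Frobenius power p ^ s with 0 < s < m forces m = 2 * s: m
    divides 2 * s because all of L is fixed by the power p ^ (2 * s). *)
Lemma norm_onto_fixed : involutive (fun x : L => x ^+ (p ^ s)) ->
  forall t : L, t ^+ (p ^ s) = t -> exists x, x * x ^+ (p ^ s) = t.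
Proof.
have /andP [s_gt0 s_lt_m] := s_bounds => sK t.
apply: norm_onto_subfield; first by rewrite -(exp1n s) ltn_exp2r ?prime_gt1.
have K1T : K1 L p (s * 2) = setT.
  by apply/setP => x; rewrite !inE muln2 -addnn expnD exprM; apply/eqP/sK.
have s2_gt0 : (0 < s * 2)%N by rewrite muln_gt0 s_gt0.
have := card_K1 s2_gt0; rewrite K1T cardsT cardL => /eqP.
rewrite eqn_exp2l ?prime_gt1 // => /eqP mE.
rewrite -expnM; congr expn; apply/eqP.
have /dvdnP [k kE] : (m %| s * 2)%N by rewrite mE dvdn_gcdr.
have k2 : (k < 2)%N by rewrite -(ltn_pmul2r m_gt0) -kE mulnC ltn_pmul2l.
case: k k2 kE => [|[|//]] _; rewrite ?mul1n; last by move->.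
by move/eqP; rewrite muln_eq0 orbF eqn0Ngt s_gt0.
Qed.

End FixedField.

End FiniteFields.

(** * Nuclei of the associated semifield as autotopisms *)

Section Isotopy.

Local Open Scope ring_scope.

Variables (F : finZmodType) (mul : F -> F -> F) (e : F).
Hypotheses (psf : presemifield mul) (e_neq0 : e != 0).

Local Notation circ := (assoc_mul mul e).
Local Notation gam := (assoc_gamma mul e).
Local Notation beta := (assoc_beta mul e).

Let inj_e := presemifield_mulIl psf e_neq0.
Let injr_e := presemifield_mulIr psf e_neq0.
Let betaK x := assoc_betaK x psf e_neq0.
Let gammaK x := assoc_gammaK x psf e_neq0.

Let circE x y : mul e (circ x y) = mul (gam x) y.
Proof. exact: betaK. Qed.

Let gamma_surj v : exists x, v = gam x.
Proof.
by exists (beta (mul v e)); apply: injr_e; rewrite /= gammaK betaK.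
Qed.

Let betaM x : beta (mul e x) = x.
Proof. by apply: inj_e; rewrite betaK. Qed.

Let betaD : {morph beta : x y / x + y}.
Proof. by move=> x y; apply: inj_e; case: psf => _ mulDr _; rewrite mulDr !betaK. Qed.

Let circ_semifield := assoc_semifield psf e_neq0.

(** The right nucleus consists of the u whose right multiplication T commutes
    with all left multiplications of the semifield.  The left multiplication by
    x is M^-1 after v * _, where M = e * _ and v = gamma x takes every value,
    so with S = M T M^-1 the condition involves the given product only. *)
Lemma right_nucleusP u :
  (u \in right_nucleus circ) <->
  exists S T : F -> F, [/\ {morph S : x y / x + y},
    forall v y, S (mul v y) = mul v (T y) & T e = u].
Proof.
have [[circDl circDr _] circ1l circ1r] := circ_semifield.
split=> [|[S [T [SD ST Te]]]].
  rewrite inE => /forallP nuc.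
  exists (fun z => mul e (circ (beta z) u)), (fun y => circ y u); split=> //.
    by move=> x y; case: psf => _ mulDr _; rewrite betaD circDl mulDr.
  move=> v y; have [x ->] := gamma_surj v.
  by rewrite -!circE betaM; have /forallP/(_ y)/eqP -> := nuc x.
have circT z : circ z u = T z.
  by apply: inj_e; rewrite circE -Te -!ST gammaK.
rewrite inE; apply/forallP => x; apply/forallP => y; apply/eqP.
by rewrite !circT; apply: inj_e; rewrite circE -!ST circE.
Qed.

(** The mirror image of the previous argument, with S = M L M^-1 and
    U = gamma L gamma^-1 for the left multiplication L by u.  Since gamma u
    equals U e, the vector u is recovered from U e through e * u = U e * e. *)
Lemma left_nucleusP u :
  (u \in left_nucleus circ) <->
  exists S U : F -> F, [/\ {morph S : x y / x + y},
    forall x y, S (mul x y) = mul (U x) y & mul (U e) e = mul e u].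
Proof.
have [[circDl circDr _] circ1l circ1r] := circ_semifield.
split=> [|[S [U [SD SU Ue]]]].
  rewrite inE => /forallP nuc.
  exists (fun z => mul e (circ u (beta z))).
  exists (fun v => gam (circ u (beta (mul v e)))); split.
  - by move=> x y; case: psf => _ mulDr _; rewrite betaD circDr mulDr.
  - move=> v y; have [x ->] := gamma_surj v.
    by rewrite gammaK betaM -!circE betaM; have /forallP/(_ y)/eqP -> := nuc x.
  - by rewrite gammaK betaM circ1r.
have gam_u : gam u = U e by apply: injr_e; rewrite /= gammaK -Ue.
have circS z : mul e (circ u z) = S (mul e z) by rewrite circE gam_u SU.
have gam_circ x : gam (circ u x) = U (gam x).
  by apply: injr_e; rewrite /= gammaK circS -gammaK SU.
rewrite inE; apply/forallP => x; apply/forallP => y; apply/eqP.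
by apply: inj_e; rewrite circE gam_circ -SU -circE circS.
Qed.

End Isotopy.

(** * Products from sesquilinear forms *)

Section SesquilinearProduct.

Local Open Scope ring_scope.

Variables (L : finFieldType) (sigma : {rmorphism L -> L}).

(** With Phi((a, b), (c, d)) = a * sigma c - al * b * sigma d
    - be * a * sigma d - ga * b * sigma c, the first component is
    Phi((a, b), (c, - d)) + l * Phi((c, - d), (a, b)). *)
Definition sesq_mul (l al be ga : L) (u v : (L * L)%type) : (L * L)%type :=
  let: (a, b) := u in let: (c, d) := v in
  (a * sigma c + al * b * sigma d + be * a * sigma d - ga * b * sigma c
     + l * (sigma a * c + al * sigma b * d + ga * sigma a * d - be * sigma b * c),
   a * d + b * c).

(** The restriction of Phi to the diagonal. *)
Definition sesq_form (al be ga : L) (z : (L * L)%type) : L :=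
  z.1 * sigma z.1 - al * z.2 * sigma z.2
    - be * z.1 * sigma z.2 - ga * z.2 * sigma z.1.

Lemma sesq_mul_collinear (l al be ga : L) (z : (L * L)%type) a c :
  sesq_mul l al be ga (a * z.1, a * z.2) (c * z.1, - (c * z.2)) =
  (sesq_form al be ga z * (a * sigma c + l * sigma a * c), 0).
Proof. by congr pair; rewrite /= /sesq_form; ring. Qed.

Hypothesis sigma_moves : exists x, sigma x != x.

(** The identity and [sigma] are linearly independent. *)
Lemma semilinear_eq0 (A B : L) :
  (forall y, A * y = B * sigma y) -> A = 0 /\ B = 0.
Proof.
move=> AB; have [x xP] := sigma_moves.
have eAB : A = B by have := AB 1; rewrite rmorph1 !mulr1.
suff A0 : A = 0 by split; rewrite -?eAB.
apply/eqP; move/eqP: (AB x); rewrite -eAB -subr_eq0 -mulrBr mulf_eq0 subr_eq0.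
by rewrite [x == _]eq_sym (negPf xP) orbF.
Qed.

Hypothesis norm_surj : involutive sigma ->
  forall t, sigma t = t -> exists x, x * sigma x = t.

(** Completing the square turns Q(a, b) into
    N(a - ga * b) - (al + N(ga)) * N(b), with N(x) = x * sigma x, where [sigma]
    fixes al + N(ga).  So an isotropic vector with b = 1 is found by solving
    N(a - ga) = al + N(ga). *)
Lemma hermitian_isotropic al be ga : involutive sigma ->
  (forall z, sigma (sesq_form al be ga z) = sesq_form al be ga z) ->
  exists2 z : (L * L)%type, z != 0 & sesq_form al be ga z = 0.
Proof.
move=> sK herm.
have alE : sigma al = al.
  have := herm (0, 1); rewrite /sesq_form /= !rmorph0 !rmorph1.
  by rewrite !(mul0r, mulr0, mulr1, add0r, subr0) rmorphN => /oppr_inj.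
have [_ gaE] : sigma ga - be = 0 /\ ga - sigma be = 0.
  apply: semilinear_eq0 => y; have := herm (y, 1).
  rewrite /sesq_form /= !(rmorphB, rmorphD, rmorphM, rmorph1) sK alE => h.
  by apply/esym/(eq_of_sub_eq h); ring.
move/eqP: gaE; rewrite subr_eq0 => /eqP gaE.
have [|t tE] := norm_surj sK (_ : sigma (al + be * ga) = _).
  by rewrite gaE rmorphD rmorphM sK alE [sigma be * _]mulrC.
exists (t + ga, 1); first by apply/eqP => -[_ /eqP]; rewrite oner_eq0.
rewrite /sesq_form /= rmorph1 rmorphD gaE sK; rewrite gaE in tE.
have -> : al = t * sigma t - be * sigma be by rewrite tE; ring.
by ring.
Qed.

(** If f is nonzero, putting c = 1 shows that f is, on each line z, a nonzero
    multiple of the inverse of phi : a |-> a + l * sigma a, scaled by Q z; so f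
    is injective and can be cancelled.  The equation between polynomials in a
    and sigma a that remains contradicts anisotropy through
    [hermitian_isotropic]. *)
Lemma form_factor_eq0 (l al be ga : L) (f : L -> L) (tau : (L * L)%type -> L -> L) :
    l != 0 -> (forall t, t + l * sigma t = 0 -> t = 0) ->
    (forall z, sesq_form al be ga z = 0 -> z = 0) ->
    (forall z a c, f (sesq_form al be ga z * (a * sigma c + l * sigma a * c))
                   = a * tau z c) ->
  forall x, f x = 0.
Proof.
move=> l0 lP aniso ftau; set Q := sesq_form al be ga in aniso ftau *.
pose phi a := a + l * sigma a.
have phi_inj : injective phi.
  move=> a b ab; apply/eqP; rewrite -subr_eq0; apply/eqP/lP.
  by apply: (eq_of_sub_eq ab); rewrite /phi; ring.
have phi_surj x : exists a, phi a = x by exists (invF phi_inj x); rewrite f_invF.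
have fphi z a : f (Q z * phi a) = a * tau z 1.
  by rewrite -ftau rmorph1 !mulr1.
have fQ z x : z != 0 -> exists a, x = Q z * phi a.
  move=> z0; have Qz : Q z != 0 by apply: contraNneq z0 => /aniso ->.
  by have [a aE] := phi_surj (x / Q z); exists a; rewrite aE mulrC divfK.
move=> x; apply/eqP; apply/negPn/negP => fx.
have tau_neq0 z : z != 0 -> tau z 1 != 0.
  move=> z0; have [a aE] := fQ z x z0.
  by apply: contraNneq fx => tz; rewrite aE fphi tz mulr0.
pose e := (1, 0) : (L * L)%type.
have e_neq0 : e != 0 by apply/eqP => -[/eqP]; rewrite oner_eq0.
have Qe : Q e = 1 by rewrite /Q /sesq_form /e /= rmorph1 rmorph0; ring.
have k0 := tau_neq0 e e_neq0.
have f_inj : injective f.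
  move=> y y'; have [a ->] := fQ e y e_neq0; have [b ->] := fQ e y' e_neq0.
  by rewrite !fphi => /(mulIf k0) ->.
have prod_phi z a c :
    Q z * (a * sigma c + l * sigma a * c) = phi (a * tau z c / tau e 1).
  apply: f_inj; rewrite ftau.
  by have := fphi e (a * tau z c / tau e 1); rewrite Qe mul1r divfK.
(* Comparing coefficients of a and sigma a on the line e gives sigma c = t and
   sigma t = c. *)
have sK : involutive sigma.
  move=> c; pose t := tau e c / tau e 1.
  have [t1 t2] : sigma c - t = 0 /\ l * (sigma t - c) = 0.
    apply: semilinear_eq0 => a; have := prod_phi e a c; rewrite Qe /phi mul1r.
    rewrite -[a * _ / _]mulrA -/t rmorphM => h.
    by apply: (eq_of_sub_eq h); ring.
  move/eqP: t1; rewrite subr_eq0 => /eqP ->.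
  by move/eqP: t2; rewrite mulf_eq0 (negPf l0) subr_eq0 => /eqP.
have [z|z z0 Qz] := @hermitian_isotropic al be ga sK; last first.
  by rewrite (aniso z Qz) eqxx in z0.
(* Comparing the line z with the line e, where Q e = 1, gives Q z = r and
   sigma r = Q z. *)
rewrite -/Q; pose r := tau z 1 / tau e 1.
have [t1 t2] : Q z - r = 0 /\ l * (sigma r - Q z) = 0.
  apply: semilinear_eq0 => a; have := prod_phi z a 1.
  rewrite rmorph1 -[a * _ / _]mulrA -/r /phi rmorphM => h.
  by apply: (eq_of_sub_eq h); ring.
move/eqP: t1; rewrite subr_eq0 => /eqP t1.
move/eqP: t2; rewrite mulf_eq0 (negPf l0) subr_eq0 => /eqP t2.
by rewrite {1}t1.
Qed.

(** [form_factor_eq0] is applied twice on collinear vectors: to the second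
    component of S (x, 0), which makes T act by one scalar w, and then to the
    first component of S (x, 0) minus w * x, which shows that [sigma] fixes
    w. *)
Lemma right_autotopism_scalar (l al be ga : L) (S T : L * L -> L * L) :
    l != 0 -> presemifield (sesq_mul l al be ga) ->
    {morph S : x y / x + y} ->
    (forall v y, S (sesq_mul l al be ga v y) = sesq_mul l al be ga v (T y)) ->
  exists2 w, sigma w = w & forall y, T y = (w * y.1, w * y.2).
Proof.
move=> l0 psf SD ST.
(* The absence of zero divisors gives the two hypotheses of form_factor_eq0. *)
have lP t : t + l * sigma t = 0 -> t = 0.
  move=> t0; case: psf => _ _ /(_ (t, 0) (1, 0)) [||] /=.
  - by rewrite rmorph0 rmorph1 !(mulr0, mul0r, mulr1, addr0, subr0) t0.
  - by case.
  - by case=> /eqP; rewrite oner_eq0.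
have aniso z : sesq_form al be ga z = 0 -> z = 0.
  case: z => a b Q0; case: psf => _ _ /(_ (a, b) (a, - b)) [||] //.
    have := sesq_mul_collinear l al be ga (a, b) 1 1.
    by rewrite Q0 /= !mul1r => ->; rewrite mul0r.
  by case=> -> /eqP; rewrite oppr_eq0 => /eqP ->.
have S0 : S 0 = 0 by apply: (addrI (S 0)); rewrite -SD !addr0.
have S3 x : (S (x, 0)).2 = 0.
  move: x; apply: (form_factor_eq0 (l := l) (al := al) (be := be) (ga := ga)
    (tau := fun z c => let t := T (c * z.1, - (c * z.2)) in
                       z.1 * t.2 + z.2 * t.1)) => //.
  move=> z a c; rewrite -sesq_mul_collinear ST.
  by case: (T _) => t1 t2 /=; ring.
have S4 a b c d : (S (0, a * d + b * c)).2 = a * (T (c, d)).2 + b * (T (c, d)).1.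
  have := congr1 snd (ST (a, b) (c, d)); rewrite /=; set h := (X in S (X, _)).
  have -> : (h, a * d + b * c) = (h, 0) + (0, a * d + b * c).
    by congr pair; rewrite /= ?addr0 ?add0r.
  by rewrite SD /= S3 add0r => ->; case: (T _).
pose w := (S (0, 1)).2.
have T2 c d : (T (c, d)).2 = (S (0, d)).2.
  by have := S4 1 0 c d; rewrite !mul1r !mul0r !addr0.
have T1 c d : (T (c, d)).1 = (S (0, c)).2.
  by have := S4 0 1 c d; rewrite !mul1r !mul0r !add0r.
have Sw a : (S (0, a)).2 = w * a.
  by have := S4 a 0 0 1; rewrite T2 !mul0r !addr0 mulr1 mulrC.
have TE y : T y = (w * y.1, w * y.2).
  by case: y => c d; rewrite [LHS]surjective_pairing T1 T2 !Sw.
have S1 z a c : (S (sesq_form al be ga z * (a * sigma c + l * sigma a * c), 0)).1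
    = sesq_form al be ga z * (a * sigma (w * c) + l * sigma a * (w * c)).
  rewrite -sesq_mul_collinear ST TE /= -[RHS]/((_, 0 : L).1).
  by rewrite -sesq_mul_collinear /= -!mulrN !mulrA.
exists w => //.
have S1w x : (S (x, 0)).1 - w * x = 0.
  move: x; apply: (form_factor_eq0 (l := l) (al := al) (be := be) (ga := ga)
    (tau := fun z c => sesq_form al be ga z * (sigma w - w) * sigma c)) => //.
  by move=> z a c; rewrite S1 rmorphM; ring.
have := S1w (1 + l); have := S1 (1, 0) 1 1.
rewrite /sesq_form /= !(rmorph1, rmorph0, mulr1, mulr0, mul1r, subr0) => ->.
by move=> h; apply: (eq_of_sub_eq h); ring.
Qed.

Lemma sesq_mul_scalel l al be ga w u v : sigma w = w ->
  sesq_mul l al be ga (w * u.1, w * u.2) v =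
  (w * (sesq_mul l al be ga u v).1, w * (sesq_mul l al be ga u v).2).
Proof.
by case: u v => a b [c d] sw; congr pair; rewrite /= ?rmorphM ?sw; ring.
Qed.

Lemma sesq_mul_scaler l al be ga w u v : sigma w = w ->
  sesq_mul l al be ga u (w * v.1, w * v.2) =
  (w * (sesq_mul l al be ga u v).1, w * (sesq_mul l al be ga u v).2).
Proof.
by case: u v => a b [c d] sw; congr pair; rewrite /= ?rmorphM ?sw; ring.
Qed.

(** Exchanging the arguments exchanges the two terms Phi(u, v') and
    l * Phi(v', u); the signs of the mixed coefficients change because the
    conjugation (c, d) |-> (c, - d) now falls on the other argument. *)
Lemma sesq_mulC (l al be ga : L) u v : l != 0 ->
  sesq_mul l al be ga u v =
  (l * (sesq_mul l^-1 al (- be) (- ga) v u).1,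
   (sesq_mul l^-1 al (- be) (- ga) v u).2).
Proof.
by case: u v => a b [c d] l0; congr pair; rewrite /=; [field | ring].
Qed.

Lemma opp_sesq_presemifield (l al be ga : L) : l != 0 ->
  presemifield (sesq_mul l al be ga) ->
  presemifield (sesq_mul l^-1 al (- be) (- ga)).
Proof.
move=> l0 psf; split.
- by move=> [a b] [a' b'] [c d]; congr pair; rewrite /= ?rmorphD; ring.
- by move=> [a b] [a' b'] [c d]; congr pair; rewrite /= ?rmorphD; ring.
move=> u v uv0; case: psf => _ _ /(_ v u) [||]; [|by right|by left].
by rewrite sesq_mulC // uv0 mulr0.
Qed.

(** * The nuclei *)

Section Nuclei.

Variables (mul : L * L -> L * L -> L * L) (l al be ga : L).
Hypotheses (mulE : mul =2 sesq_mul l al be ga) (psf : presemifield mul).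
Hypothesis l_neq0 : l != 0.

Let psf_sesq : presemifield (sesq_mul l al be ga).
Proof.
case: psf => mulDl mulDr mul_eq0; split=> x y *; rewrite -?mulE //.
by apply: mul_eq0; rewrite mulE.
Qed.

Let e0_scale (w : L) : (w, 0) = (w * (e0 L).1, w * (e0 L).2).
Proof. by rewrite /= mulr1 mulr0. Qed.

Lemma right_nucleus_sesq :
  right_nucleus (assoc_mul mul (e0 L)) = embed [set w | sigma w == w].
Proof.
apply/setP => u; apply/idP/imsetP => [|[w]].
  case/(right_nucleusP psf (e0_neq0 L)) => S [T [SD ST <-]].
  have [|w sw TE] := @right_autotopism_scalar _ _ _ _ S T l_neq0 psf_sesq SD.
    by move=> v y; rewrite -!mulE.
  by exists w; rewrite ?inE ?sw // TE e0_scale.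
rewrite inE => /eqP sw ->; apply/(right_nucleusP psf (e0_neq0 L)).
exists (fun y => (w * y.1, w * y.2)), (fun y => (w * y.1, w * y.2)); split.
- by move=> x y; congr pair; rewrite /= mulrDr.
- by move=> v y; rewrite !mulE sesq_mul_scaler.
- by rewrite -e0_scale.
Qed.

Lemma left_nucleus_sesq :
  left_nucleus (assoc_mul mul (e0 L)) = embed [set w | sigma w == w].
Proof.
apply/setP => u; apply/idP/imsetP => [|[w]].
  case/(left_nucleusP psf (e0_neq0 L)) => S [U [SD SU Ue]].
  (* Conjugating S by the scaling of the first component by l passes to the
     opposite product. *)
  pose S' z := let: y := S (l * z.1, z.2) in (l^-1 * y.1, y.2).
  have S'D : {morph S' : x y / x + y}.
    move=> x y; rewrite /S' /= [l * _]mulrDr.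
    have -> : (l * x.1 + l * y.1, x.2 + y.2) =
              (l * x.1, x.2) + (l * y.1, y.2) by [].
    by rewrite SD; congr pair; rewrite /= mulrDr.
  have S'U v y : S' (sesq_mul l^-1 al (- be) (- ga) v y)
      = sesq_mul l^-1 al (- be) (- ga) v (U y).
    rewrite /S' -sesq_mulC // -mulE SU mulE sesq_mulC //= mulKf //.
    by rewrite -surjective_pairing.
  have [w sw UE] := right_autotopism_scalar (invr_neq0 l_neq0)
    (opp_sesq_presemifield l_neq0 psf_sesq) S'D S'U.
  exists w; first by rewrite inE sw.
  apply: (presemifield_mulIl psf (e0_neq0 L)); rewrite -Ue UE e0_scale !mulE.
  by rewrite sesq_mul_scalel // sesq_mul_scaler.
rewrite inE => /eqP sw ->; apply/(left_nucleusP psf (e0_neq0 L)).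
exists (fun y => (w * y.1, w * y.2)), (fun y => (w * y.1, w * y.2)); split.
- by move=> x y; congr pair; rewrite /= mulrDr.
- by move=> v y; rewrite !mulE sesq_mul_scalel.
- by rewrite e0_scale !mulE sesq_mul_scalel // sesq_mul_scaler.
Qed.

End Nuclei.

End SesquilinearProduct.

(** * The two families *)

Section FrobeniusPower.

Local Open Scope ring_scope.

Variables (L : finFieldType) (p : nat).
Hypothesis pcharLp : p \in [pchar L].
Variable s : nat.

(** The proof that L has characteristic p is an argument so that the ring
    morphism structure can be attached to the function. *)
Definition frobenius_power of p \in [pchar L] := fun x : L => x ^+ (p ^ s).

Local Notation frob := (frobenius_power pcharLp).

Fact frobenius_power_additive : nmod_morphism frob.
Proof.
split=> [|x y]; rewrite /frobenius_power.
  by rewrite expr0n expn_eq0 -leqn0 leqNgt prime_gt0 ?(pcharf_prime pcharLp).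
by rewrite exprDn_pchar // pnatX pnatE ?pcharLp ?(pcharf_prime pcharLp).
Qed.

Fact frobenius_power_monoid : monoid_morphism frob.
Proof. by split=> [|x y]; rewrite /frobenius_power ?expr1n ?exprMn. Qed.

HB.instance Definition _ :=
  GRing.isNmodMorphism.Build L L frob frobenius_power_additive.
HB.instance Definition _ :=
  GRing.isMonoidMorphism.Build L L frob frobenius_power_monoid.

Definition frobenius_power_rmorphism : {rmorphism L -> L} := frob.

End FrobeniusPower.

Theorem theorem8p21 (p m s : nat) (L : finFieldType)
    (p_prime : prime p) (p_odd : odd p)
    (cardL : #|L| = (p ^ m)%N) (s_bounds : (0 < s < m)%N) :
  #|K1 L p s| = (p ^ gcdn m s)%N /\
  (forall l n N : L, B_params p s l n N ->
     left_nucleus (assoc_mul (B_mul p s l n N) (e0 L)) = embed (K1 L p s) /\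
     right_nucleus (assoc_mul (B_mul p s l n N) (e0 L)) = embed (K1 L p s)) /\
  (forall l R : L, C_params p s l R ->
     left_nucleus (assoc_mul (C_mul p s l R) (e0 L)) = embed (K1 L p s) /\
     right_nucleus (assoc_mul (C_mul p s l R) (e0 L)) = embed (K1 L p s)).
Proof.
have pcharLp := card_finPcharP cardL p_prime.
pose sigma := frobenius_power_rmorphism pcharLp s.
have sigma_moves : exists x, sigma x != x := K1_proper p_prime cardL s_bounds.
have norm_surj := norm_onto_fixed p_prime cardL s_bounds.
split; first by apply: card_K1 => //; case/andP: s_bounds.
split=> [l n N params | l R params].
- have psf := B_presemifield p_prime cardL params; have [[l0 _ _] _ _] := params.
  have mulE : B_mul p s l n N =2 sesq_mul sigma l (- (n * N))%R (n * N)%R n.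
    by move=> [a b] [c d]; congr pair; rewrite /= /frobenius_power; ring.
  split; first exact: left_nucleus_sesq mulE psf l0.
  exact: right_nucleus_sesq mulE psf l0.
- have psf := C_presemifield p_prime cardL params; have [l0 _ _ _] := params.
  have mulE : C_mul p s l R =2 sesq_mul sigma l R 0%R 0%R.
    by move=> [a b] [c d]; congr pair; rewrite /= /frobenius_power; ring.
  split; first exact: left_nucleus_sesq mulE psf l0.
  exact: right_nucleus_sesq mulE psf l0.
Qed.
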